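(* Let $0\le\alpha<n$, $0<\delta<\min\{\gamma,(n-\alpha)/m\}$, $1\le r\le\infty$, $\tilde\delta\le\delta$, and $\tilde\alpha=m\delta+\alpha$. If $w\in\mathbb{H}(r,\tilde\alpha,\tilde\delta)$, then $\tilde\delta=\tilde\alpha-n/r$.
   Context: Here $n\ge1$, $m\in\mathbb{N}\cup\{0\}$, $0<\gamma\le 1$ is a fixed number, $(n-\alpha)/m=\infty$ if $m=0$, and $n/r=0$ if $r=\infty$. A weight is a locally integrable function on $\mathbb{R}^n$ with values in $(0,\infty)$ almost everywhere. $r'$ denotes the conjugate exponent of $r$ ($r'=1$ if $r=\infty$). A ball $B\subset\mathbb{R}^n$ has center $x_B$. For $1<r\le\infty$ a weight $w$ belongs to $\mathbb{H}(r,\tilde\alpha,\tilde\delta)$ (a class that also depends on $\delta$) if $$\sup_B\|(1/w)\chi_B\|_{\infty}|B|^{\frac{\delta-\tilde\delta}{n}}\left(\int_{\mathbb{R}^n}\frac{w^{r'}(y)}{\left(|B|^{1/n}+|x_B-y|\right)^{r'(n-\tilde\alpha+\delta)}}\,dy\right)^{1/r'}<\infty,$$ the supremum being over all balls $B$. For $r=1$ the condition is $$\sup_B\|(1/w)\chi_B\|_{\infty}|B|^{\frac{\delta-\tilde\delta}{n}}\left\|\frac{w(\cdot)}{\left(|B|^{1/n}+|x_B-\cdot|\right)^{n-\tilde\alpha+\delta}}\right\|_{\infty}<\infty.$$ *)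

(* Defs.v *)
From HB Require Import structures.
From mathcomp Require Import all_boot all_order all_algebra.
From mathcomp Require Import all_classical all_reals all_analysis.

Set Implicit Arguments.
Unset Strict Implicit.
Unset Printing Implicit Defensive.

Import Order.TTheory GRing.Theory Num.Theory.
Import numFieldNormedType.Exports.

Local Open Scope classical_set_scope.
Local Open Scope ring_scope.

Section lebesgue_outer.
Context {R : realType} {n : nat}.
Implicit Types (A : set 'rV[R]_n) (c : option ('rV[R]_n * 'rV[R]_n)).

(* [Some (a, b)] is the half-open box of all x with a_i < x_i <= b_i.  [None]
   is the empty set: it pads finite covers, and is needed when n = 0, where no
   box is empty. *)
Definition box c : set 'rV[R]_n :=
  if c is Some (a, b) then
    [set x | forall i : 'I_n, a ord0 i < x ord0 i <= b ord0 i]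
  else set0.

Definition box_vol c : R :=
  if c is Some (a, b) then \prod_(i < n) Num.max 0 (b ord0 i - a ord0 i)
  else 0.

Local Open Scope ereal_scope.

Definition lebesgue_outer A : \bar R :=
  ereal_inf [set \sum_(k <oo) (box_vol (F k))%:E | F in
    [set F : nat -> option ('rV[R]_n * 'rV[R]_n) |
      A `<=` \bigcup_k box (F k)]].

Lemma box_vol_ge0 c : (0 <= box_vol c)%R.
Proof.
by case: c => [[a b]|] //=; apply: prodr_ge0 => i _; rewrite le_max lexx.
Qed.

Let vol_ge0 c : 0 <= (box_vol c)%:E.
Proof. by rewrite lee_fin box_vol_ge0. Qed.

Lemma lebesgue_outer_ge0 A : 0 <= lebesgue_outer A.
Proof.
by apply: le_ereal_inf_tmp => x [F AF <-{x}]; exact: nneseries_ge0.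
Qed.

Lemma lebesgue_outer0 : lebesgue_outer set0 = 0.
Proof.
apply/eqP; rewrite eq_le lebesgue_outer_ge0 andbT.
apply: ereal_inf_lbound; exists (fun=> None) => //=.
exact: eseries0.
Qed.

Lemma le_lebesgue_outer : {homo lebesgue_outer : A B / A `<=` B >-> A <= B}.
Proof.
move=> A B AB; apply/ereal_inf_le_tmp => x [F BF <-{x}].
by exists F => //; exact: subset_trans AB BF.
Qed.

Lemma lebesgue_outer_sigma_subadditive : sigma_subadditive lebesgue_outer.
Proof.
move=> A; have [[i ioo]|] := pselect (exists i, lebesgue_outer (A i) = +oo).
  rewrite (eseries_pinfty _ _ ioo) ?leey// => k _.
  by rewrite -ltNye (lt_le_trans _ (lebesgue_outer_ge0 _)).
rewrite -forallNE => Aoo.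
suff add2e (e : {posnum R}) : lebesgue_outer (\bigcup_k A k) <=
    \sum_(i <oo) lebesgue_outer (A i) + e%:num%:E.
  by apply/lee_addgt0Pr => _/posnumP[].
rewrite (le_trans _ (epsilon_trick _ _ _))//; last first.
  by move=> k; exact: lebesgue_outer_ge0.
pose P k (F : nat -> option ('rV[R]_n * 'rV[R]_n)) :=
  A k `<=` \bigcup_j box (F j) /\ \sum_(j <oo) (box_vol (F j))%:E <=
    lebesgue_outer (A k) + (e%:num / (2 ^ k.+1)%:R)%:E.
have [G PG] : {G & forall k, P k (G k)}.
  apply: (@choice _ _ P) => k; rewrite /P /lebesgue_outer.
  set S := (X in ereal_inf X).
  have Sfin : ereal_inf S \is a fin_num.
    by rewrite ge0_fin_numE ?lebesgue_outer_ge0// ltey; apply/eqP/Aoo.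
  have e0 : (0 < e%:num / (2 ^ k.+1)%:R)%R by [].
  have [x [F AF <-] xS] := lb_ereal_inf_adherent e0 Sfin.
  by exists F; split => //; exact/ltW.
pose v (p : nat * nat) := (box_vol (uncurry G p))%:E.
have v_ge0 p : 0 <= v p by exact: vol_ge0.
apply: (@le_trans _ _ (\esum_(i in setT) v i)).
  apply: ereal_inf_lbound => /=.
  have /card_esym/ppcard_eqP[f] := card_nat2.
  exists (uncurry G \o f).
    move=> t [i _ /(PG i).1[j _ Gt]]; exists (f^-1%FUN (i, j)) => //=.
    by rewrite invK ?inE.
  rewrite -(esum_pred_image v _ xpredT) ?[fun=> _]set_true//.
  by rewrite image_eq.
rewrite (_ : esum _ _ = \sum_(i <oo) \sum_(j <oo) v (i, j)); last first.
  pose J : nat -> set (nat * nat) := fun i => [set (i, j) | j in setT].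
  rewrite (_ : setT = \bigcup_k J k); last first.
    by rewrite predeqE => -[a b]; split => // _; exists a => //; exists b.
  rewrite esum_bigcupT /=; last 2 first.
    - apply/trivIsetP => i j _ _ ij.
      rewrite predeqE => -[k m] /=; split => //= -[] [_] _ [<-{k} _].
      by move=> [m' _] [] /esym/eqP; rewrite (negbTE ij).
    - by move=> /= p; exact: v_ge0.
  rewrite -(image_id [set: nat]) -fun_true esum_pred_image//; last first.
    by move=> k _; exact: esum_ge0.
  apply: eq_eseriesr => /= j _.
  rewrite -(esum_pred_image v (pair j) predT)//=; last first.
    by move=> ? ? _ _; exact: (@can_inj _ _ _ snd).
  by congr esum; rewrite predeqE => -[a b]; split; move=> [i _ <-]; exists i.
by apply: lee_nneseries => [i _ _|i _]; [exact: nneseries_ge0|exact: (PG i).2].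
Qed.

HB.instance Definition _ := isOuterMeasure.Build R 'rV[R]_n lebesgue_outer
  lebesgue_outer0 lebesgue_outer_ge0 le_lebesgue_outer
  lebesgue_outer_sigma_subadditive.

End lebesgue_outer.

(* R^n with the sigma-algebra of Lebesgue measurable sets. *)
Notation Rn R n := (caratheodory_type (@lebesgue_outer R n)).

Definition lebesgue_Rn (R : realType) (n : nat) : set (Rn R n) -> \bar R :=
  lebesgue_outer.
HB.instance Definition _ (R : realType) (n : nat) :=
  isMeasure.Build _ (Rn R n) R (@lebesgue_Rn R n)
    (@caratheodory_measure0 _ _ (@lebesgue_outer R n))
    (@caratheodory_measure_ge0 _ _ (@lebesgue_outer R n))
    (@caratheodory_measure_sigma_additive _ _ (@lebesgue_outer R n)).

Section weights.
Context {R : realType} {n : nat}.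
Implicit Types (x y : 'rV[R]_n) (w : 'rV[R]_n -> R).
Local Notation mu := (@lebesgue_Rn R n).

(* The library norm and balls of 'rV[R]_n are those of the sup norm. *)
Definition enorm x : R := Num.sqrt (\sum_(i < n) x ord0 i ^+ 2).

Definition eball x (rho : R) : set 'rV[R]_n := [set y | enorm (y - x) < rho].

Local Open Scope ereal_scope.

Definition is_weight w :=
  [/\ measurable_fun [set: Rn R n] (w : Rn R n -> R),
      forall K : set 'rV[R]_n, compact K -> \int[mu]_(y in K) `|w y|%:E < +oo
    & {ae mu, forall y, (0 < w y)%R}].

Definition ball_kernel x (rho : R) y : R :=
  (fine (mu (eball x rho)) `^ n%:R^-1 + enorm (x - y))%R.

(* The product, for the ball eball x rho, whose supremum over balls defines
   H(r, ta, td); d, ta, td stand for delta, tilde alpha, tilde delta. *)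
Definition Hterm (r : \bar R) (d ta td : R) w x (rho : R) : \bar R :=
  let B := eball x rho in
  let q := fine (hoelder_conjugate r) in
  'N[mu]_+oo[(fun y => ((w y)^-1 * \1_B y)%:E)]
  * (fine (mu B) `^ ((d - td) / n%:R))%:E
  * (if r == 1 then
       'N[mu]_+oo[(fun y => (w y / ball_kernel x rho y `^ (n%:R - ta + d))%:E)]
     else
       (\int[mu]_y (w y `^ q
          / ball_kernel x rho y `^ (q * (n%:R - ta + d)))%:E) `^ q^-1).

Definition in_H (r : \bar R) (d ta td : R) w :=
  ereal_sup [set Hterm r d ta td w p.1 p.2 |
    p in [set p : 'rV[R]_n * R | (0 < p.2)%R]] < +oo.

End weights.

(* Main.v *)
Require Import Defs.
From HB Require Import structures.
From mathcomp Require Import all_boot all_order all_algebra.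
From mathcomp Require Import all_classical all_reals all_analysis.
From mathcomp Require Import measurable_realfun ess_sup_inf.
From mathcomp Require Import ring lra.
Set Implicit Arguments.
Unset Strict Implicit.
Unset Printing Implicit Defensive.
Import Order.TTheory GRing.Theory Num.Theory.
Import numFieldNormedType.Exports.
Local Open Scope classical_set_scope.
Local Open Scope ring_scope.

(* On a ball B of radius t the kernel is at most 3t, and w is almost everywhere
   at least the inverse of M = ||(1/w) 1_B||_oo.  In the product M * |B|^_ * J
   whose supremum defines H(r, ta, td), the third factor J is therefore at
   least M^-1 |B|^(1/r') (3t)^-(n - ta + d): M cancels, and since |B| is
   comparable to t^n the product is at least a positive constant times
   t^(ta - n/r - td).  This stays bounded as t ranges over (0, +oo) only if the
   exponent vanishes. *)

(** * The outer measure of a box *)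

(* Induction on the dimension: a slice of a covered box is covered by the
   slices of the boxes, and integrating the slice inequality in the last
   coordinate multiplies each term by the length of the last side. *)
Lemma prod_le_cover_vol (R : realType) (n : nat) (l u : nat -> R)
    (P : nat -> bool) (a b : nat -> nat -> R) :
  (forall i, (i < n)%N -> l i <= u i) ->
  (forall x : nat -> R, (forall i, (i < n)%N -> l i < x i <= u i) ->
    exists2 k, P k & forall i, (i < n)%N -> a k i < x i <= b k i) ->
  ((\prod_(i < n) (u i - l i))%:E <=
   \sum_(k <oo) (if P k then \prod_(i < n) Num.max 0 (b k i - a k i)
                 else 0)%:E)%E.
Proof.
have V0 (m k : nat) (Q : bool) :
    (0 <= (if Q then \prod_(i < m) Num.max 0 (b k i - a k i) else 0 : R)%:E)%E.
  by case: ifP => // _; rewrite lee_fin prodr_ge0// => i _; rewrite le_max lexx.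
elim: n P => [|n IHn] P lu cov.
  (* In dimension 0 both the left side and every selected term are empty products, equal to 1; the
     cover provides one selected index. *)
  have [//|k Pk _] := cov (fun=> 0).
  rewrite big_ord0.
  apply: (le_trans _ (nneseries_lim_ge k.+1 _)) => [|i _ _]; last exact: V0.
  rewrite big_nat_recr//= Pk big_ord0 -[X in (X <= _)%E]add0e leeD//.
  by apply: sume_ge0 => i _; exact: V0.
pose D : set R := `]l n, u n]%classic.
pose c k : R := if P k then \prod_(i < n) Num.max 0 (b k i - a k i) else 0.
pose I k : set R := `]a k n, b k n]%classic.
have mD : measurable D by exact: measurable_itv.
have mI k : measurable (I k) by exact: measurable_itv.
have c0 k : (0 <= (c k)%:E)%E by exact: V0.
have slice t : D t -> ((\prod_(i < n) (u i - l i))%:E <=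
    \sum_(k <oo) ((c k)%:E * (\1_(I k) t)%:E))%E.
  rewrite /D /= in_itv /= => Dt.
  have /IHn : forall i, (i < n)%N -> l i <= u i by move=> i /ltnW; exact: lu.
  (* The selector [P] exists for this step: it is narrowed to the boxes whose last side contains
     [t]. *)
  move=> /(_ (fun k => P k && (a k n < t <= b k n))) H.
  apply: (le_trans (H _)) => [x xP|].
    have [i|k Pk kP] := cov (fun i => if i == n then t else x i).
      rewrite ltnS leq_eqVlt; case: eqVneq => [->//|_ /=]; exact: xP.
    exists k; first by rewrite Pk; have := kP n (ltnSn n); rewrite eqxx.
    by move=> i iltn; have := kP i (ltnW iltn); rewrite ltn_eqF.
  apply: lee_nneseries => [k _ _|k _]; first exact: V0.
  rewrite -EFinM lee_fin /c indicE.
  have -> : (t \in I k) = (a k n < t <= b k n).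
    by apply/idP/idP; rewrite inE /I/= in_itv.
  by case: (P k); case: (_ < t <= _); rewrite /= ?mulr1 ?mulr0.
have lun : l n <= u n by exact: lu.
have muI p q : lebesgue_measure (`]p, q]%classic : set R) =
    (Num.max 0 (q - p))%:E.
  rewrite lebesgue_measure_itv/= lte_fin; case: ltP => pq.
    by rewrite max_r// subr_ge0 ltW.
  by rewrite max_l// subr_le0.
have prod_ge0 : 0 <= \prod_(i < n) (u i - l i).
  by apply: prodr_ge0 => i _; rewrite subr_ge0 lu// ltnW// ltnS.
rewrite big_ord_recr/=.
have -> : ((\prod_(i < n) (u i - l i) * (u n - l n))%:E =
    \int[lebesgue_measure]_(t in D) (cst (\prod_(i < n) (u i - l i))%:E) t)%E.
  by rewrite integral_cst//= /D muI max_r ?subr_ge0.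
pose f k t : \bar R := ((c k)%:E * (\1_(I k) t)%:E)%E.
have mind k : measurable_fun D (EFin \o (\1_(I k) : R -> R)).
  by apply/measurable_EFinP; exact: measurable_indic.
have mf k : measurable_fun D (f k) := measurable_funeM (c k)%:E (mind k).
have f0 k t : (0 <= f k t)%E by rewrite mule_ge0// lee_fin.
apply: (@le_trans _ _ (\int[lebesgue_measure]_(t in D) \sum_(k <oo) f k t)%E).
  apply: ge0_le_integral => //.
  by apply: (@ge0_emeasurable_sum _ _ _ D f xpredT) => [? ? _ _|? _].
rewrite integral_nneseries//.
apply: lee_nneseries => [k _ _|k _].
  exact: integral_ge0.
rewrite ge0_integralZl//; last exact: mind.
rewrite integral_indic; [|exact: mD|exact: mI].
apply: (@le_trans _ _ ((c k)%:E * lebesgue_measure (I k))%E).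
  apply: lee_pmul => //.
  apply: le_measure; rewrite ?inE; [|exact: mI|exact: subIsetl].
  exact: (measurableI _ _ (mI k) mD).
rewrite /I muI -EFinM lee_fin /c; case: (P k); last by rewrite mul0r.
by rewrite big_ord_recr.
Qed.

Section boxes.
Variables (R : realType) (n : nat).
Implicit Types (a b : 'rV[R]_n).
Local Open Scope ereal_scope.

Lemma lebesgue_outer_box_le a b :
  lebesgue_outer (box (Some (a, b))) <= (box_vol (Some (a, b)))%:E.
Proof.
apply: ereal_inf_lbound.
exists (fun k => if k == 0%N then Some (a, b) else None).
  by move=> x xab; exists 0%N.
rewrite (nneseries_split _ 1)//; last by move=> k _; rewrite lee_fin box_vol_ge0.
rewrite big_mkord big_ord1/= eseries0 ?adde0// => -[|k]//.
Qed.

Lemma lebesgue_outer_box a b : (forall i, a ord0 i <= b ord0 i)%R ->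
  lebesgue_outer (box (Some (a, b))) = (\prod_(i < n) (b ord0 i - a ord0 i))%:E.
Proof.
move=> ab; apply/eqP; rewrite eq_le; apply/andP; split.
  apply: (le_trans (lebesgue_outer_box_le a b)); rewrite lee_fin/=.
  by apply: ler_prod => i _; rewrite le_max lexx/= max_r ?subr_ge0.
apply: le_ereal_inf_tmp => _ [F abF <-].
(* The induction on the dimension indexes coordinates by [nat], so vectors are extended by 0 beyond
   [n]. *)
pose ext (v : 'rV[R]_n) i := if insub i is Some j then v ord0 j else 0%R.
have extE v (i : 'I_n) : ext v i = v ord0 i by rewrite /ext valK.
under eq_bigr do rewrite -!extE.
(* As a boolean, [F k] is true exactly on [Some], so the default [(0, 0)] is never selected. *)
apply: (le_trans (@prod_le_cover_vol R n (ext a) (ext b) (fun k => F k : bool)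
  (fun k => ext (odflt (0, 0) (F k)).1)%R
  (fun k => ext (odflt (0, 0) (F k)).2)%R _ _)) => [i iltn|x xab|].
- by have := ab (Ordinal iltn); rewrite -!extE.
- have [|k _] := abF (\row_i x i).
    by move=> i; rewrite mxE -!extE; exact: xab.
  case E : (F k) => [[p q]|//] xpq; exists k; first by rewrite E.
  move=> i iltn; rewrite E/=.
  by have := xpq (Ordinal iltn); rewrite mxE -!extE.
apply: lee_nneseries => [k _ _|k _].
  rewrite lee_fin; case: ifP => // _; apply: prodr_ge0 => i _.
  by rewrite le_max lexx.
rewrite lee_fin; case: (F k) => [[p q]|//]/=.
by under eq_bigr do rewrite !extE.
Qed.

End boxes.

(** * Carathéodory measurability of half-spaces and boxes *)

Section halfspaces.
Variables (R : realType) (n : nat).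
Implicit Types (a b x : 'rV[R]_n).

Let upd x (i : 'I_n) c : 'rV[R]_n :=
  \row_j (if j == i then c else x ord0 j).

Let clip_le i c (o : option ('rV[R]_n * 'rV[R]_n)) :=
  omap (fun ab => (ab.1, upd ab.2 i (Num.min (ab.2 ord0 i) c))) o.

Let clip_gt i c (o : option ('rV[R]_n * 'rV[R]_n)) :=
  omap (fun ab => (upd ab.1 i (Num.max (ab.1 ord0 i) c), ab.2)) o.

(** Only side [i] changes, and its length splits at [c]. If the cut misses the box, the reversed
    side is truncated to 0 by the maximum in [box_vol]. *)
Let box_vol_clip i c o :
  box_vol (clip_le i c o) + box_vol (clip_gt i c o) = box_vol o.
Proof.
case: o => [[a b]|]/=; last by rewrite addr0.
rewrite !(bigD1 (P := xpredT) i)//=.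
under eq_bigr => j /negbTE ji do rewrite mxE ji.
under [X in _ + _ * X]eq_bigr => j /negbTE ji do rewrite mxE ji.
rewrite !mxE eqxx -mulrDl; congr (_ * _).
move: (a _ _) (b _ _) => p q; rewrite /Num.max /Num.min.
by repeat case: ifPn; lra.
Qed.

(** Cutting each box of a cover of [X] along the hyperplane gives covers of the two pieces of [X]
    with the same total volume, which is Carathéodory's criterion. *)
Lemma measurable_halfspace (i : 'I_n) (c : R) :
  measurable ([set x | x ord0 i <= c] : set (Rn R n)).
Proof.
apply: le_caratheodory_measurable => X /=; apply: le_ereal_inf_tmp.
move=> _ [F XF <-].
have v0 o : (0 <= (@box_vol R n o)%:E)%E by rewrite lee_fin box_vol_ge0.
have -> : (\sum_(k <oo) (box_vol (F k))%:E =
    \sum_(k <oo) (box_vol (clip_le i c (F k)))%:E +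
    \sum_(k <oo) (box_vol (clip_gt i c (F k)))%:E)%E.
  rewrite -nneseriesD//; apply: eq_eseriesr => k _.
  by rewrite -EFinD box_vol_clip.
apply: leeD; apply: ereal_inf_lbound.
- exists (fun k => clip_le i c (F k)) => // x [/XF[k _ xFk] xH]; exists k => //.
  move: xFk; case: (F k) => [[a b]|]//= abx j; rewrite !mxE.
  case: eqP => [->|_]//; have /andP[-> bx] := abx i.
  by rewrite le_min bx.
- exists (fun k => clip_gt i c (F k)) => // x [/XF[k _ xFk] xH]; exists k => //.
  move: xFk; case: (F k) => [[a b]|]//= abx j; rewrite !mxE.
  case: eqP => [->|_]//; have /andP[ax ->] := abx i.
  by rewrite gt_max ax/= andbT ltNge; apply/negP; exact: xH.
Qed.

Lemma measurable_box a b : measurable (box (Some (a, b)) : set (Rn R n)).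
Proof.
have -> : box (Some (a, b)) = \bigcap_(i in [set: 'I_n])
    (~` [set x : 'rV_n | x ord0 i <= a ord0 i] `&`
     [set x | x ord0 i <= b ord0 i]).
  apply/seteqP; split => x /= xab i; rewrite -?ltNge.
    by have /andP[ax xb] := xab i; split => //=; apply/negP;
      rewrite -ltNge.
  have [/negP ax /= xb] := xab i Logic.I.
  by rewrite ltNge ax.
apply: fin_bigcap_measurable => // i _.
by apply: measurableI; [apply: measurableC|]; exact: measurable_halfspace.
Qed.

End halfspaces.

(** * Integrals and essential suprema bounded below almost everywhere *)

Section measure.
Context d (T : measurableType d) (R : realType).
Variable mu : {measure set T -> \bar R}.
Import HBNNSimple.
Local Open Scope ereal_scope.

Lemma ae_exists_in (A : set T) (P : set T) :
  measurable A -> 0 < mu A -> (\forall y \ae mu, P y) ->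
  exists2 y, A y & P y.
Proof.
move=> mA A0 [N [mN N0 PN]]; apply: contrapT => noy.
have : mu A <= mu N.
  apply: le_measure; rewrite ?inE// => y Ay; apply: PN => /= Py.
  by apply: noy; exists y.
by rewrite N0 leNgt A0.
Qed.

Lemma cst_le_integral (A : set T) (c : R) (f : T -> \bar R) :
  measurable A -> (0 <= c)%R -> (forall y, 0 <= f y) ->
  (\forall y \ae mu, A y -> c%:E <= f y) ->
  c%:E * mu A <= \int[mu]_y f y.
Proof.
(* [ge0_le_integral] would need [f] measurable; a simple function below [f]
   does not. *)
move=> mA c0 f0 [N [mN N0 AN]].
(* Removing the null set [N] keeps the measure of [A] and makes the bound hold at every remaining
   point. *)
have mAN : measurable (A `\` N) by exact: measurableD.
pose h := scale_nnsfun (indic_nnsfun R mAN) c0.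
have -> : c%:E * mu A = \int[mu]_y (h y)%:E.
  transitivity (\int[mu]_y (c%:E * (\1_(A `\` N) y)%:E)).
    rewrite ge0_integralZl//; last first.
      by apply/measurable_EFinP; exact: measurable_indic.
    rewrite integral_indic// setIT; congr (_ * _).
    rewrite (measureDI mu mA mN).
    rewrite [X in _ + X](_ : _ = 0) ?adde0//.
    apply/eqP; rewrite -measure_le0 -N0 le_measure ?inE//.
    exact: measurableI.
  by apply: eq_integral => y _.
rewrite integralT_nnsfun ge0_integralTE//; apply: ereal_sup_ubound => /=.
exists h => // y; rewrite (_ : h y = c * (y \in A `\` N)%:R)%R//.
have [yAN|_] := boolP (y \in _); last by rewrite mulr0 f0.
rewrite mulr1; move: yAN; rewrite inE => -[Ay Ny].
by apply: contrapT => cf; apply: Ny; apply: AN => /= /(_ Ay).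
Qed.

Lemma cst_le_ess_sup (A : set T) (c : \bar R) (f : T -> \bar R) :
  measurable A -> 0 < mu A ->
  (\forall y \ae mu, A y -> c <= f y) -> c <= ess_sup mu f.
Proof.
move=> mA A0 cf.
have [y Ay [cfy fy]] := ae_exists_in mA A0 (filterI cf (ess_sup_ge mu f)).
exact: le_trans (cfy Ay) fy.
Qed.

(** The bound w >= 1/M on B, written with inverses so that it also makes sense for M = +oo. *)
Lemma inv_le_ess_sup (B : set T) (w : T -> R) :
  (\forall y \ae mu, (0 < w y)%R) ->
  \forall y \ae mu, B y -> (0 < w y)%R /\
    (w y)^-1%:E <= ess_sup mu (abse \o (fun y => ((w y)^-1 * \1_B y)%:E)).
Proof.
move=> wpos; set f := (abse \o _).
apply: filterS (filterI wpos (ess_sup_ge mu f)) => y [wy fy] By; split => //.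
by apply: le_trans fy; rewrite /f/= indicE mem_set// mulr1 lee_fin ler_norm.
Qed.

(* Otherwise [A] would be covered up to a null set by the null sets
   [A `&` {w >= 1/(k+1)}]. *)
Lemma ae_gt0_lower_bound (A : set T) (w : T -> R) :
  measurable A -> 0 < mu A -> measurable_fun [set: T] w ->
  (\forall y \ae mu, (0 < w y)%R) ->
  exists s A', [/\ (0 < s)%R, measurable A', A' `<=` A, 0 < mu A' &
    \forall y \ae mu, A' y -> (s <= w y)%R].
Proof.
move=> mA A0 mw wpos.
pose B k := A `&` w @^-1` `[k.+1%:R^-1%R, +oo[%classic.
have mB k : measurable (B k).
  by apply: measurableI => //; rewrite -[X in measurable X]setTI; exact: mw.
have [[k Bk0]|noB] := pselect (exists k, 0 < mu (B k)).
  exists k.+1%:R^-1%R, (B k); split => //.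
    exact: subIsetl.
  by apply: nearW => y [_] /=; rewrite in_itv/= andbT.
have : mu.-negligible (\bigcup_k B k).
  apply: negligible_bigcup => k; apply/negligibleP => //.
  apply/eqP; rewrite eq_le measure_ge0 andbT leNgt; apply/negP => Bk.
  by apply: noB; exists k.
move=> Bnull.
have Bae : \forall y \ae mu, ~ (\bigcup_k B k) y.
  by apply: negligibleS Bnull => y /contrapT.
have [y Ay [wy By]] := ae_exists_in mA A0 (filterI wpos Bae).
(* With k the integer part of 1/w(y), k + 1 exceeds 1/w(y), so [y] lies in [B k]. *)
case: By; exists (Num.truncn (w y)^-1%R) => //; split => //=.
rewrite in_itv/= andbT invf_ple ?posrE//.
by apply: ltW; exact: truncnS_gt.
Qed.

End measure.

(** * Euclidean balls compared with cubes *)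

Section ball.
Variables (R : realType) (n : nat).
Implicit Types x y : 'rV[R]_n.
Local Notation mu := (@lebesgue_Rn R n).

Definition cube x (s : R) : set 'rV[R]_n :=
  box (Some (\row_i (x ord0 i - s), \row_i (x ord0 i + s))).

Lemma cubeP x s y :
  cube x s y <-> forall i, x ord0 i - s < y ord0 i <= x ord0 i + s.
Proof. by split=> /= + i => /(_ i); rewrite !mxE. Qed.

Lemma measurable_cube x s : measurable (cube x s : set (Rn R n)).
Proof. exact: measurable_box. Qed.

Lemma lebesgue_Rn_cube x s : 0 <= s -> mu (cube x s) = ((s *+ 2) ^+ n)%:E.
Proof.
move=> s0; rewrite /lebesgue_Rn lebesgue_outer_box => [|i]; last first.
  by rewrite !mxE lerD2l (le_trans _ s0)// oppr_le0.
under eq_bigr do rewrite !mxE opprD opprK addrACA subrr add0r -mulr2n.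
by rewrite prodr_const card_ord.
Qed.

Lemma enormB x y : enorm (x - y) = enorm (y - x).
Proof. by congr Num.sqrt; apply: eq_bigr => i _; rewrite -opprB mxE sqrrN. Qed.

Lemma ler_enorm x i : `|x ord0 i| <= enorm x.
Proof.
rewrite -sqrtr_sqr /enorm ler_sqrt; last first.
  by apply: sumr_ge0 => j _; exact: sqr_ge0.
by rewrite (bigD1 i)//= lerDl sumr_ge0// => j _; exact: sqr_ge0.
Qed.

(** The sum of squares is at most n s^2 <= (n s)^2; the factor n is cruder than its square root but
    keeps the constants rational. *)
Lemma enorm_le x s : 0 <= s -> (forall i, `|x ord0 i| <= s) ->
  enorm x <= s *+ n.
Proof.
move=> s0 xs; rewrite -(ger0_norm (mulrn_wge0 n s0)) -sqrtr_sqr.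
rewrite ler_sqrt ?sqr_ge0//.
have : \sum_(i < n) x ord0 i ^+ 2 <= \sum_(i < n) s ^+ 2.
  apply: ler_sum => i _; rewrite -[x _ _ ^+ 2]real_normK ?num_real//.
  by rewrite lerXn2r ?nnegrE// xs.
rewrite sumr_const card_ord => /le_trans; apply.
rewrite -mulr_natl -[s *+ n]mulr_natl exprMn ler_wpM2r ?sqr_ge0//.
case: (n) => [|m]; first by rewrite expr0n.
by rewrite expr2 ler_peMl// ler1n.
Qed.

Lemma eball_sub_cube x s : eball x s `<=` cube x s.
Proof.
move=> y /= xys; apply/cubeP => i.
have := le_lt_trans (ler_enorm (y - x) i) xys.
by rewrite !mxE ltr_norml; lra.
Qed.

(** Half-side s/(2n) keeps the distance to the centre at most s/2, hence strictly below s, and makes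
    the side exactly s/n. *)
Lemma cube_sub_eball x s : (0 < n)%N -> 0 < s ->
  cube x (s / n%:R / 2) `<=` eball x s.
Proof.
move=> n0 s0 y /cubeP xy; rewrite /eball/=.
have n0' : 0 < n%:R :> R by rewrite ltr0n.
apply: (@le_lt_trans _ _ ((s / n%:R / 2) *+ n)).
  apply: enorm_le => [|i]; first by rewrite !divr_ge0// ltW.
  by have := xy i; rewrite !mxE ler_norml; lra.
by rewrite -mulr_natr mulrAC divfK ?gt_eqF//; lra.
Qed.

Lemma lebesgue_Rn_eball x s : (0 < n)%N -> 0 < s ->
  [/\ mu (eball x s) \is a fin_num, (s / n%:R) ^+ n <= fine (mu (eball x s)) &
      fine (mu (eball x s)) <= (s *+ 2) ^+ n].
Proof.
move=> n0 s0.
have up : (mu (eball x s) <= ((s *+ 2) ^+ n)%:E)%E.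
  rewrite -(lebesgue_Rn_cube x (ltW s0)).
  exact: (@le_lebesgue_outer R n _ _ (@eball_sub_cube x s)).
have low : (((s / n%:R) ^+ n)%:E <= mu (eball x s))%E.
  rewrite (_ : s / n%:R = (s / n%:R / 2) *+ 2); last by lra.
  rewrite -(lebesgue_Rn_cube x) ?divr_ge0 ?(ltW s0)//.
  exact: (@le_lebesgue_outer R n _ _ (cube_sub_eball n0 s0)).
have fin : mu (eball x s) \is a fin_num.
  by rewrite ge0_fin_numE ?lebesgue_outer_ge0// (le_lt_trans up)// ltry.
by split; rewrite // -lee_fin fineK.
Qed.

(** The constant 3 is 2 + 1: |B| <= (2s)^n bounds the first summand by 2s, and the distance is below
    s. Positivity comes from |B| > 0. *)
Lemma ball_kernel_bounds x s y : (0 < n)%N -> 0 < s -> eball x s y ->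
  0 < ball_kernel x s y <= s *+ 3.
Proof.
move=> n0 s0; rewrite /eball/= -enormB => xy.
have [_ low up] := lebesgue_Rn_eball x n0 s0.
have n0' : 0 < n%:R :> R by rewrite ltr0n.
have V0 : 0 < fine (mu (eball x s)).
  by apply: lt_le_trans low; rewrite exprn_gt0// divr_gt0.
rewrite /ball_kernel ltr_pwDl ?powR_gt0 ?sqrtr_ge0//=.
have : fine (mu (eball x s)) `^ n%:R^-1 <= s *+ 2.
  have s2 : 0 <= s *+ 2 by rewrite mulrn_wge0// ltW.
  rewrite [leRHS](_ : _ = ((s *+ 2) ^+ n) `^ n%:R^-1); last first.
    by rewrite -powR_mulrn// -powRrM mulfV ?powRr1// lt0r_neq0.
  by apply: ge0_ler_powR; rewrite ?nnegrE ?invr_ge0 ?exprn_ge0// ltW.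
lra.
Qed.

End ball.

(** * Lower bound for the product defining H(r, ta, td) *)

Section Hterm.
Variables (R : realType) (n : nat).
Hypothesis n0 : (0 < n)%N.
Implicit Types (x y : 'rV[R]_n) (w : 'rV[R]_n -> R) (r : \bar R).
Local Notation mu := (@lebesgue_Rn R n).

Lemma fine_hoelder_conjugate_gt0 r : (1 <= r)%E -> r != 1%E ->
  0 < fine (hoelder_conjugate r).
Proof.
rewrite /hoelder_conjugate; case: r => [p| |]//= p1 pN1.
have {pN1 p1} p1 : 1 < p by rewrite lt_neqAle eq_sym -eqe pN1 -lee_fin.
have p0 : 0 < p by exact: lt_trans p1.
rewrite eqe gt_eqF// inver subr_eq0 gt_eqF// -EFinM/=.
by rewrite divr_gt0 ?subr_gt0.
Qed.

(** This is n/r = n - n/r'. At r = 1 the conjugate is +oo, [fine] sends it to 0 and [0^-1 = 0], so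
    the real inverse still represents 1/r'. *)
Lemma div_hoelder_conjugate r : (1 <= r)%E ->
  (n%:R%:E / r)%E = (n%:R - n%:R * (fine (hoelder_conjugate r))^-1)%:E.
Proof.
have [->|rN1] := eqVneq r 1%E.
  by rewrite hoelder_conjugate1 inve1 mule1 invr0 mulr0 subr0.
rewrite /hoelder_conjugate; case: r rN1 => [p| |]// pN1 p1; last first.
  by rewrite invey mule0 /= invr1 mulr1 subrr.
have {pN1}p1 : 1 < p by rewrite lt_neqAle eq_sym -eqe pN1 -lee_fin.
have p0 : 0 < p by exact: lt_trans p1.
rewrite /= eqe gt_eqF// -EFinB !inver subr_eq0 !gt_eqF// -!EFinM/=.
by congr EFin; field; rewrite subr_eq0 !gt_eqF.
Qed.

Definition kernel_norm r (e : R) w x (rho : R) : \bar R :=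
  (if r == 1 then
     'N[mu]_+oo[(fun y => (w y / ball_kernel x rho y `^ e)%:E)]
   else
     (\int[mu]_y (w y `^ fine (hoelder_conjugate r)
        / ball_kernel x rho y `^ (fine (hoelder_conjugate r) * e))%:E)
     `^ (fine (hoelder_conjugate r))^-1)%E.

Lemma HtermE r d ta td w x rho : Hterm r d ta td w x rho =
  ('N[mu]_+oo[(fun y => ((w y)^-1 * \1_(eball x rho) y)%:E)]
   * (fine (mu (eball x rho)) `^ ((d - td) / n%:R))%:E
   * kernel_norm r (n%:R - ta + d) w x rho)%E.
Proof. by []. Qed.

(** On [A] the quotient is at least s / (3 rho)^e almost everywhere, and the norm of a constant on
    [A] contributes |A|^(1/r'). The set [A] is left free: it is a cube when M is finite and a
    smaller set when M = +oo. *)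
Lemma kernel_norm_ge r e w x rho (A : set (Rn R n)) s :
  (1 <= r)%E -> 0 <= e -> 0 < rho -> 0 < s ->
  measurable A -> A `<=` eball x rho -> (0 < mu A)%E ->
  (\forall y \ae mu, A y -> s <= w y) ->
  ((s * fine (mu A) `^ (fine (hoelder_conjugate r))^-1
    / (rho *+ 3) `^ e)%:E <= kernel_norm r e w x rho)%E.
Proof.
move=> r1 e0 rho0 s0 mA AB A0 sw.
have rho3 : 0 < rho *+ 3 by rewrite pmulrn_lgt0.
have kle (t : R) y : 0 <= t -> A y ->
    0 < ball_kernel x rho y `^ t <= (rho *+ 3) `^ t.
  move=> t0 /AB /(ball_kernel_bounds n0 rho0) /andP[k0 k3].
  by rewrite powR_gt0//= ge0_ler_powR// nnegrE ltW.
have muAfin : mu A \is a fin_num.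
  have [Bfin _ _] := lebesgue_Rn_eball x n0 rho0.
  move: Bfin; rewrite !ge0_fin_numE ?lebesgue_outer_ge0//.
  exact: (le_lt_trans (@le_lebesgue_outer R n _ _ AB)).
rewrite /kernel_norm; case: eqVneq => [->|rN1].
  rewrite hoelder_conjugate1/= invr0 powRr0 mulr1 unlock.
  rewrite (lt_le_trans A0); last by apply: le_measure; rewrite ?inE.
  apply: (cst_le_ess_sup mA A0); apply: filterS sw => y sw Ay /=.
  have /andP[k0 k3] := kle e y e0 Ay.
  have {}sw := sw Ay.
  rewrite lee_fin ger0_norm ?divr_ge0 ?powR_ge0 ?(le_trans (ltW s0))//.
  by rewrite ler_pM ?invr_ge0 ?powR_ge0 ?(ltW s0)// lef_pV2 ?posrE ?k0 ?powR_gt0.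
set q := fine (hoelder_conjugate r).
have q0 : 0 < q by exact: fine_hoelder_conjugate_gt0.
set I := (\int[_]_ _ _)%E.
have : ((s `^ q / (rho *+ 3) `^ (q * e))%:E * mu A <= I)%E.
  apply: cst_le_integral => //.
  - by rewrite divr_ge0 ?powR_ge0.
  - by move=> y; rewrite lee_fin divr_ge0 ?powR_ge0.
  - apply: filterS sw => y sw Ay.
    have /andP[k0 k3] := kle (q * e) y (mulr_ge0 (ltW q0) e0) Ay.
    have {}sw := sw Ay.
    rewrite lee_fin ler_pM ?invr_ge0 ?powR_ge0 ?lef_pV2 ?posrE ?k0 ?powR_gt0//.
    by rewrite ge0_ler_powR ?nnegrE ?(ltW q0) ?(ltW s0) ?(le_trans (ltW s0)).
move=> cI; have I0 : (0 <= I)%E.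
  by apply: le_trans cI; rewrite mule_ge0 ?lee_fin ?divr_ge0 ?powR_ge0.
rewrite (_ : (_ / _)%:E = ((s `^ q / (rho *+ 3) `^ (q * e))%:E * mu A) `^ q^-1)%E.
  apply: gt0_ler_poweR => //; first by rewrite invr_ge0 ltW.
    by rewrite in_itv/= leey andbT mule_ge0 ?lee_fin ?divr_ge0 ?powR_ge0.
  by rewrite in_itv/= leey andbT.
rewrite -(fineK muAfin) -EFinM poweR_EFin; congr EFin.
have A0' : 0 <= fine (mu A) by rewrite fine_ge0.
rewrite powRM ?divr_ge0 ?powR_ge0// powRM ?invr_ge0 ?powR_ge0//.
rewrite -!powRN -!powRrM mulfV ?gt_eqF// powRr1 ?ltW// mulNr.
by rewrite (mulrAC q) mulfV ?gt_eqF// mul1r mulrAC.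
Qed.

(** The exponent of rho/n collects d - td from the power of |B| and n/r' from the volume of an
    inscribed cube; [td <= d] lets the lower bound on |B| pass to its power. *)
Lemma Hterm_ge r d ta td w x rho : (1 <= r)%E -> 0 <= n%:R - ta + d ->
  td <= d -> is_weight w -> 0 < rho ->
  (((rho / n%:R) `^ (d - td + n%:R * (fine (hoelder_conjugate r))^-1)
   / (rho *+ 3) `^ (n%:R - ta + d))%:E <= Hterm r d ta td w x rho)%E.
Proof.
move=> r1 e0 tdd [mw _ wpos] rho0; rewrite HtermE.
set e := n%:R - ta + d; set q := fine (hoelder_conjugate r).
have n0' : 0 < n%:R :> R by rewrite ltr0n.
have nN0 : n%:R != 0 :> R by rewrite gt_eqF.
have sig0 : 0 < rho / n%:R by rewrite divr_gt0.
have [Bfin Vlow _] := lebesgue_Rn_eball x n0 rho0.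
set V := fine (mu (eball x rho)) in Vlow *.
have V0 : 0 < V by apply: lt_le_trans Vlow; rewrite exprn_gt0.
(* The inscribed cube replaces the ball: it is measurable with volume (rho/n)^n. *)
pose Q : set (Rn R n) := cube x (rho / n%:R / 2).
have mQ : measurable Q by exact: measurable_cube.
have QB : Q `<=` eball x rho by exact: cube_sub_eball.
have muQ : mu Q = ((rho / n%:R) ^+ n)%:E.
  rewrite lebesgue_Rn_cube; last by rewrite divr_ge0// ltW.
  by congr (_ ^+ _)%:E; lra.
have Q0 : (0 < mu Q)%E by rewrite muQ lte_fin exprn_gt0.
(* The norm at +oo unfolds to the essential supremum only when the whole space has positive
   measure. *)
rewrite unlock; have -> : (0 < mu [set: Rn R n])%E.
  by apply: (lt_le_trans Q0); apply: le_measure; rewrite ?inE.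
set M := ess_sup _ _.
have inv_le_M : \forall y \ae mu, Q y -> 0 < w y /\ ((w y)^-1%:E <= M)%E.
  have := @inv_le_ess_sup _ (Rn R n) R mu (eball x rho) w wpos.
  by apply: filterS => y wM Qy; apply: wM; exact: QB.
have M0 : (0 < M)%E.
  have [y Qy /(_ Qy)[wy yM]] := ae_exists_in mQ Q0 inv_le_M.
  by apply: lt_le_trans yM; rewrite lte_fin invr_gt0.
have rho3 : 0 < rho *+ 3 by rewrite pmulrn_lgt0.
have sE : ((rho / n%:R) ^+ n) `^ ((d - td) / n%:R) = (rho / n%:R) `^ (d - td).
  by rewrite -powR_mulrn ?(ltW sig0)// -powRrM mulrCA mulfV// mulr1.
have Vpow : (rho / n%:R) `^ (d - td) <= V `^ ((d - td) / n%:R).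
  rewrite -sE ge0_ler_powR ?nnegrE ?divr_ge0 ?subr_ge0 ?exprn_ge0//.
  - exact: ltW.
  - exact: ltW.
(* If M = +oo, the product is +oo once the kernel norm is positive; for this, [w] is bounded below
   by some s > 0 on a part of [Q] of positive measure. *)
case: M M0 inv_le_M => [m| |]// M0 inv_le_M; last first.
  have [s [A [s0 mA AQ A0 sw]]] := ae_gt0_lower_bound mQ Q0 mw wpos.
  have AB : A `<=` eball x rho by exact: subset_trans QB.
  have J0 : (0 < kernel_norm r e w x rho)%E.
    apply: lt_le_trans (kernel_norm_ge r1 e0 rho0 s0 mA AB A0 sw).
    rewrite lte_fin divr_gt0 ?powR_gt0// mulr_gt0//.
    rewrite powR_gt0// fine_gt0// A0 -ge0_fin_numE ?measure_ge0//=.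
    move: Bfin; rewrite !ge0_fin_numE ?lebesgue_outer_ge0//.
    exact: (le_lt_trans (@le_lebesgue_outer R n _ _ AB)).
  by rewrite gt0_mulye ?lte_fin ?powR_gt0// gt0_mulye// leey.
have m0 : 0 < m by rewrite -lte_fin.
have mw' : \forall y \ae mu, Q y -> m^-1 <= w y.
  apply: filterS inv_le_M => y H /H[wy].
  by rewrite lee_fin => ?; rewrite invf_ple ?posrE.
have := kernel_norm_ge r1 e0 rho0 (_ : 0 < m^-1) mQ QB Q0 mw'.
rewrite invr_gt0 => /(_ m0); rewrite -/e -/q muQ/= => KJ.
apply: le_trans (lee_pmul _ _ (lexx (m%:E * (V `^ ((d - td) / n%:R))%:E)%E) KJ).
- rewrite -!EFinM lee_fin mulrA ler_wpM2r ?invr_ge0 ?powR_ge0//.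
  rewrite powRD; last by rewrite (gt_eqF sig0) implybT.
  rewrite mulrACA divff ?gt_eqF// mul1r -powR_mulrn ?(ltW sig0)// -powRrM.
  by rewrite ler_wpM2r ?powR_ge0.
- by rewrite -EFinM lee_fin mulr_ge0 ?powR_ge0 ?ltW.
- by rewrite lee_fin divr_ge0 ?mulr_ge0 ?powR_ge0// invr_ge0 ltW.
Qed.

End Hterm.

(** * Vanishing of the exponent *)

(** If E were nonzero, of either sign, t = (C/K + 1)^(1/E) would give K t^E = C + K > C. *)
Lemma powR_bounded_exponent0 (R : realType) (K C E : R) : 0 < K ->
  (forall t, 0 < t -> K * t `^ E <= C) -> E = 0.
Proof.
move=> K0 KC; apply/eqP; apply: contraT => E0.
have C0 : 0 < C / K + 1.
  have := KC 1 ltr01; rewrite powR1 mulr1 => KC1.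
  by rewrite addr_gt0// divr_gt0// (lt_le_trans K0).
have := KC ((C / K + 1) `^ E^-1) (powR_gt0 _ C0).
rewrite -powRrM mulVf// powRr1 ?(ltW C0)// mulrDr mulr1 mulrCA mulfV ?gt_eqF// mulr1.
by rewrite gerDl leNgt K0.
Qed.

(* In the extended reals x / 0 = +oo for x > 0, and x / +oo = 0. *)
Theorem lemma2p2 (R : realType) (n m : nat) (gamma alpha delta talpha tdelta : R)
    (r : \bar R) (w : 'rV[R]_n -> R)
    (hn : (1 <= n)%N)
    (hgamma : 0 < gamma <= 1)
    (halpha : 0 <= alpha < n%:R)
    (hdelta0 : 0 < delta)
    (hdelta : (delta%:E < Order.min gamma%:E ((n%:R - alpha)%:E / m%:R%:E))%E)
    (hr : (1 <= r)%E)
    (htdelta : tdelta <= delta)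
    (htalpha : talpha = m%:R * delta + alpha)
    (hweight : is_weight w)
    (hw : in_H r delta talpha tdelta w) :
  (tdelta%:E = talpha%:E - n%:R%:E / r)%E.
Proof.
have n0 : 0 < n%:R :> R by rewrite ltr0n.
have e0 : 0 <= n%:R - talpha + delta.
  (* For [m = 0] the quotient in [hdelta] is +oo, and the bound comes from alpha < n instead. *)
  have {}hdelta : m%:R * delta < n%:R - alpha.
    move: hdelta; rewrite lt_min => /andP[_]; clear htalpha.
    case: m => [|k]; first by rewrite mul0r subr_gt0; case/andP: halpha.
    by rewrite inver pnatr_eq0/= -EFinM lte_fin ltr_pdivlMr ?ltr0n// mulrC.
  by rewrite htalpha; lra.
pose b := delta - tdelta + n%:R * (fine (hoelder_conjugate r))^-1.
pose e := n%:R - talpha + delta.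
move: hw; rewrite /in_H; set S := ereal_sup _ => Soo.
have HS t : 0 < t -> (((t / n%:R) `^ b / (t *+ 3) `^ e)%:E <= S)%E.
  move=> t0; apply: (le_trans (Hterm_ge hn 0 hr e0 htdelta hweight t0)).
  by apply: ereal_sup_ubound; exists (0, t).
have Sfin : S \is a fin_num.
  rewrite fin_numElt Soo andbT.
  by apply: lt_le_trans (HS 1 ltr01); rewrite ltNyr.
have K0 : 0 < n%:R^-1 `^ b / 3 `^ e by rewrite divr_gt0 ?powR_gt0 ?invr_gt0.
have /(powR_bounded_exponent0 K0) : forall t, 0 < t ->
    n%:R^-1 `^ b / 3 `^ e * t `^ (b - e) <= fine S.
  move=> t t0; rewrite -lee_fin fineK//; apply: le_trans (HS t t0).
  rewrite lee_fin -[t *+ 3]mulr_natr !powRM ?invr_ge0 ?(ltW t0)//.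
  rewrite powRB ?(gt_eqF t0) ?implybT//.
  by rewrite invfM [leRHS]mulrACA [leRHS]mulrC.
(* Here b - e = ta - td - (n - n/r') = ta - td - n/r, so b - e = 0 is the claim. *)
rewrite div_hoelder_conjugate// -EFinB /b /e => bE; congr EFin; lra.
Qed.
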